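(* Let $\mathcal S=\{S_1,\dots,S_m\}$ be a system of injective contractions of a complete metric space whose attractor $K$ is a self-similar dendrite with finite self-similar boundary $P=\partial K$, and let $\mathcal G_P$ be the index diagram of its sprout $\Gamma$. Then: 1) If the index diagram $\mathcal G_P$ does not contain cyclic vertices of outdegree $\ge 2$, then the orders of the points of $K$ are uniformly bounded. 2) If for some vertex $p\in P$ there is an infinite walk $\omega(p,\ldots)$ in $\mathcal G_P$ starting from $p$ such that all vertices $p_i$ of $\omega(p,\ldots)$ have outdegree $1$, then all vertices $p_i$ of $\omega(p,\ldots)$ have a unique address, and it is preperiodic. 3) Let $p$ be a common vertex of two cycles of the index diagram $\mathcal G_P$. Then, for any vertex $p'\prec p$, the set $\Omega(p')$ of infinite walks in $\mathcal G_P$ starting from $p'$ is uncountable.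
   Context: The attractor $K$ of $\mathcal S$ is the unique nonempty compact set with $K=\bigcup_{i=1}^m S_i(K)$. Write $I=\{1,\dots,m\}$, $I^*=\bigcup_{n\ge1}I^n$, $S_{\mathbf j}=S_{j_1}\circ\dots\circ S_{j_n}$, $K_{\mathbf j}=S_{\mathbf j}(K)$. The critical set is $\mathcal C=\bigcup_{i\ne j}K_i\cap K_j$, and the self-similar boundary $\partial K$ is the set of all $x\in K$ with $S_{\mathbf i}(x)\in\mathcal C$ for some $\mathbf i\in I^*$. $K$ is a self-similar dendrite if it is a locally connected continuum containing no simple closed curve. The order $\mathrm{Ord}(x,K)$ of a point $x\in K$ is the number of connected components of $K\setminus\{x\}$. An address of $x\in K$ is a sequence $\alpha=\alpha_1\alpha_2\ldots\in I^\infty$ with $\{x\}=\bigcap_n K_{\alpha_1\dots\alpha_n}$; it is preperiodic if it is eventually periodic. The sprout $\Gamma$ of $\mathcal S$ is the edge-labeled bipartite graph with parts $\{K_1,\dots,K_m\}$ and $\mathcal C\cup P$, with an edge $(K_k,b)$ exactly when $b\in K_k$, labeled by the unique $q\in P$ with $S_k(q)=b$. The index diagram $\mathcal G_P$ is the edge-labeled directed graph with vertex set $P$ in which, for $p,q\in P$, there is a directed edge from $p$ to $q$ with label $w_k$ if and only if $S_k(q)=p$ (equivalently, the sprout has an edge $(K_k,p)$ with label $q$). Edges with different labels are different; loops are allowed. A walk from $p_0$ to $p_k$ is a sequence of vertices and edges $(p_0,\vec e_1,p_1,\dots,\vec e_k,p_k)$ such that each $\vec e_i$ is a directed edge from $p_{i-1}$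 to $p_i$; infinite walks are defined analogously. If $p_0=p_k$, the walk is called a cycle and its vertices are called cyclic vertices. A vertex $p'$ is a predecessor of a vertex $p$ in the digraph if there is a walk from $p'$ to $p$; $p'\prec p$ means that $p'$ is a predecessor of $p$ and $p$ is not a predecessor of $p'$. *)

(* Defs.v *)
From HB Require Import structures.
From mathcomp Require Import all_boot all_order all_algebra.
From mathcomp Require Import all_classical all_reals all_analysis.

Set Implicit Arguments.
Unset Strict Implicit.
Unset Printing Implicit Defensive.

Import Order.TTheory GRing.Theory Num.Theory.
Import numFieldTopology.Exports numFieldNormedType.Exports.

Local Open Scope classical_set_scope.
Local Open Scope card_scope.
Local Open Scope ring_scope.

#[short(type="completeMetricType")]
HB.structure Definition CompleteMetric (K : numDomainType) :=
  { M of Metric K M & Complete M }.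

(* Contractions in the library are defined on normed modules only. *)
Definition metric_contraction (R : realType) (X : metricType R) (f : X -> X) :=
  exists2 q : R, 0 <= q < 1 &
    forall x y : X, mdist (f x) (f y) <= q * mdist x y.

Definition locally_connected (T : topologicalType) (A : set T) :=
  forall x U, A x -> open U -> U x ->
    exists2 V, open V & [/\ V x, A `&` V `<=` U & connected (A `&` V)].

Definition simple_closed_curve (R : realType) (T : topologicalType)
    (C : set T) :=
  exists f : R -> T,
    [/\ {within `[0, 1], continuous f}, f 0 = f 1,
        {in `[0, 1[ &, injective f} & f @` `[0, 1] = C].

Definition dendrite (R : realType) (X : metricType R) (A : set X) :=
  [/\ A !=set0, compact A, connected A, locally_connected A &
      ~ exists2 C : set X, simple_closed_curve R C & C `<=` A].

Definition components (T : topologicalType) (A : set T) : set (set T) :=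
  [set connected_component A y | y in A].

(* Ord(x, A) <= N *)
Definition order_le (T : topologicalType) (A : set T) (x : T) (N : nat) :=
  components (A `\ x) #<= `I_N.

Section SelfSimilar.
Context {R : realType} {X : metricType R} {m : nat}.
Variables (S : 'I_m -> X -> X) (K : set X).

(* By Hutchinson's theorem at most one K satisfies this, since the S i are
   contractions. *)
Definition is_attractor :=
  [/\ K !=set0, compact K & K = \bigcup_(i in [set: 'I_m]) (S i @` K)].

Definition piece (i : 'I_m) : set X := S i @` K.

Definition word_map (w : seq 'I_m) (x : X) : X := foldr (fun i => S i) x w.

Definition word_piece (w : seq 'I_m) : set X := word_map w @` K.

Definition critical_set : set X :=
  [set x | exists i j, [/\ i != j, piece i x & piece j x]].

Definition self_similar_boundary : set X :=
  [set x | K x /\ exists2 w, w != [::] & critical_set (word_map w x)].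

Local Notation P := self_similar_boundary.

Definition is_address (x : X) (a : nat -> 'I_m) :=
  [set x] = \bigcap_(n in [set: nat]) word_piece (mkseq a n.+1).

(* The edge (K_k, b) of the sprout, labeled by q. *)
Definition sprout_edge (k : 'I_m) (b q : X) :=
  [/\ (critical_set `|` P) b, piece k b, P q & S k q = b].

(* The edge from p to q of the index diagram, labeled by w_k. *)
Definition index_edge (p : X) (k : 'I_m) (q : X) :=
  [/\ P p, P q & S k q = p].

Lemma index_edge_sprout p k q : index_edge p k q <-> P p /\ sprout_edge k p q.
Proof.
split=> [[Pp Pq Skq]|[Pp [_ _ Pq Skq]]] //.
split=> //; split=> //; first by right.
by case: Pq => Kq _; exists q.
Qed.

Definition out_edges (p : X) : set ('I_m * X) :=
  [set e | index_edge p e.1 e.2].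

(* A finite walk from p to q is given by its start p and the list s of its
   successive (label, endpoint) pairs. *)
Fixpoint is_walk (p : X) (s : seq ('I_m * X)) (q : X) : Prop :=
  if s is (k, r) :: s' then index_edge p k r /\ is_walk r s' q
  else P p /\ p = q.

Definition walk_vertices (p : X) (s : seq ('I_m * X)) : seq X :=
  p :: [seq e.2 | e <- s].

(* Edges as (source, (label, target)) triples. *)
Definition walk_edges (p : X) (s : seq ('I_m * X)) : seq (X * ('I_m * X)) :=
  zip (walk_vertices p s) s.

Definition is_cycle (p : X) (s : seq ('I_m * X)) :=
  s != [::] /\ is_walk p s p.

Definition cyclic_vertex (p : X) :=
  exists p0 s, is_cycle p0 s /\ p \in walk_vertices p0 s.

(* Cycles are closed walks, so a cycle started elsewhere or traversed several
   times must not count as a second cycle: two cycles are told apart by the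
   sets of edges they use. *)
Definition in_two_cycles (p : X) :=
  exists p1 s1 p2 s2,
    [/\ is_cycle p1 s1 /\ is_cycle p2 s2,
        p \in walk_vertices p1 s1, p \in walk_vertices p2 s2 &
        ~ walk_edges p1 s1 =i walk_edges p2 s2].

Definition predecessor (p' p : X) := exists s, is_walk p' s p.

Definition strict_predecessor (p' p : X) :=
  predecessor p' p /\ ~ predecessor p p'.

(* An infinite walk is given by its vertices w.1 and its edge labels w.2. *)
Definition infinite_walks (p : X) : set ((nat -> X) * (nat -> 'I_m)) :=
  [set w | w.1 0%N = p /\
           forall i, index_edge (w.1 i) (w.2 i) (w.1 i.+1)].

End SelfSimilar.

Definition preperiodic (T : Type) (a : nat -> T) :=
  exists N t, (0 < t)%N /\ forall n, (N <= n)%N -> a (n + t)%N = a n.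

(* Main.v *)
(* Orders: let k_n(x) be the number of words w of length n with x in K_w. The
   union of these pieces K_w is a neighbourhood of x in K whose relative
   boundary lies in the union of the sets S_w(P). Every component of K \ {x}
   accumulates at x and, for n large, leaves that union, so it contains one of
   these boundary points; hence Ord(x, K) <= sup_n k_n(x) * |P|. Words through
   a point of P are walks in the index diagram, and x has at most m preimages
   in P after its first branching, so k_n is bounded by counting walks.

   Addresses of points of P are the label sequences of infinite walks, which
   gives 2). For 3), rotate the two cycles to closed walks c1, c2 at p with
   different edge sets: c1 c2 and c2 c1 have the same length and differ, and
   may be concatenated freely into infinite walks. *)
Require Import Defs.
From HB Require Import structures.
From mathcomp Require Import all_boot all_order all_algebra.
From mathcomp Require Import all_classical all_reals all_analysis.
Import Order.TTheory GRing.Theory Num.Theory.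
Local Open Scope classical_set_scope.
Local Open Scope card_scope.

Set Implicit Arguments.
Unset Strict Implicit.
Unset Printing Implicit Defensive.

(** * Preliminaries on cardinality and connectedness *)

Lemma not_card_le_II (T : Type) (A : set T) (n : nat) :
  ~ (A #<= `I_n) -> `I_n.+1 #<= A.
Proof.
move=> An; case: (pselect (finite_set A)) => [/finite_setP[k Ak]|infA].
  rewrite (card_le_eqr Ak) card_le_II ltnNge; apply/negP => kn; apply: An.
  by rewrite (card_le_eql Ak) card_le_II.
by apply: card_le_trans (card_leT _) _; exact/infiniteP.
Qed.

(** Turns a bound on the outdegree into equality of any two outgoing edges. *)
Lemma card_lt2_unique {T : Type} {A : set T} (x y : T) :
  ~ (`I_2 #<= A) -> A x -> A y -> x = y.
Proof.
move=> A2 Ax Ay; apply: contra_notP A2 => xy.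
pose f k := if k is 0%N then x else y.
have finj : {in `I_2 &, injective f}.
  move=> [|[|a]] [|[|b]]; rewrite !inE //= => _ _ fab; by case: xy; rewrite fab.
rewrite -(card_le_eql (inj_card_eq finj)).
by apply: subset_card_le => _ [[|a] _ <-].
Qed.

(** Were [U] and [V] disjoint inside [A], the trace of [U] would also be that of the complement of
    [V], hence clopen in [A]. *)
Lemma connected_closed_cover {T : topologicalType} {A U V : set T} :
  connected A -> closed U -> closed V -> A `<=` U `|` V ->
  A `&` U !=set0 -> A `&` V !=set0 -> A `&` (U `&` V) !=set0.
Proof.
move=> cA cU cV AUV AU0 [z [Az Vz]]; apply: contrapT => AUV0.
have AUA : A `&` U = A.
  apply: cA => //; last by exists U.
  exists (~` V); first exact: closed_openC.
  apply/seteqP; split=> y [Ay Uy]; split=> //.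
    by move=> Vy; apply: AUV0; exists y.
  by case: (AUV _ Ay).
by apply: AUV0; exists z; split=> //; split=> //; move: Az; rewrite -AUA => -[].
Qed.

(** * Components of a punctured locally connected continuum *)

Section Continuum.
Context {R : realType} {X : metricType R} (K : set X).
Context (K_cpt : compact K) (K_conn : connected K) (K_lc : locally_connected K).

(* Otherwise the component would be clopen in K. *)
Lemma component_closure (x y : X) : K x -> (K `\ x) y ->
  closure (connected_component (K `\ x) y) x.
Proof.
move=> Kx Kxy; set A := connected_component _ _.
have Ay : A y by exact: connected_component_refl.
have AKx : A `<=` K `\ x by exact: connected_component_sub.
have clK : closed K by apply: compact_closed => //; exact: metric_hausdorff.
apply: contrapT => nclx.
have clA : closure A `<=` K `\ x.
  move=> z clz; split; last by move=> zx; apply: nclx; rewrite -zx.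
  by apply: clK; apply: closureS clz => u /AKx[].
have clAA : closure A `<=` A.
  move=> z clz; apply: (@connected_component_max _ _ (closure A)) => //.
    exact: subset_closure.
  by apply: connected_closure; exact: component_connected.
suff AK : A = K by have := Kx; rewrite -AK => /AKx[_]; exact.
apply: K_conn; first by exists y.
(* Openness in [K]: each point of [A] has a connected relative neighbourhood that misses [x], and
   the component absorbs it. *)
- exists (\bigcup_(V in [set V | open V /\ K `&` V `<=` A]) V).
    by apply: bigcup_open => V [].
  apply/seteqP; split=> [z Az|z [Kz [V [_ VA] Vz]]]; last exact: VA.
  have [Kz zx] := AKx _ Az; split=> //.
  have [|V oV [Vz KVx cV]] := @K_lc z (~` [set x]) Kz _ zx.
    apply: closed_openC; apply: accessible_closed_set1;
       exact/hausdorff_accessible/metric_hausdorff.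
  exists V => //; split=> // u KVu.
  apply: connected_component_trans Az _.
  apply: connected_component_max KVu => //.
  by move=> v KVv; split; [case: KVv | exact: KVx].
- exists (closure A); first exact: closed_closure.
  apply/seteqP; split=> [z Az|z [_ /clAA//]].
  by split; [case: (AKx _ Az) | exact: subset_closure].
Qed.
End Continuum.

(** * Pieces of the attractor: size, covering and intersections *)

Section Words.
Local Open Scope ring_scope.
Context {R : realType} {X : metricType R} {m : nat}.
Context (S : 'I_m -> X -> X) (K : set X).
Context (S_inj : forall i, injective (S i)).
Context (S_contr : forall i, metric_contraction (S i)).
Context (K_attr : is_attractor S K).

Local Notation P := (self_similar_boundary S K).
Local Notation word_map := (word_map S).
Local Notation word_piece := (word_piece S K).

Lemma word_map_cat u v x : word_map (u ++ v) x = word_map u (word_map v x).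
Proof. exact: foldr_cat. Qed.

Lemma attractor_map i x : K x -> K (S i x).
Proof. by case: K_attr => _ _ KE Kx; rewrite KE; exists i => //; exists x. Qed.

Lemma word_map_K w x : K x -> K (word_map w x).
Proof. by move=> Kx; elim: w => //= i w; exact: attractor_map. Qed.

Lemma attractorE x : K x -> exists i, piece S K i x.
Proof. by case: K_attr => _ _ KE; rewrite {1}KE => -[i _ ?]; exists i. Qed.

Lemma word_piece_cover n x : K x -> exists2 w, size w = n & word_piece w x.
Proof.
elim: n x => [|n IH] x Kx; first by exists [::] => //; exists x.
have [i [y Ky <-]] := attractorE Kx; have [w sw [z Kz <-]] := IH _ Ky.
by exists (i :: w); [rewrite /= sw | exists z].
Qed.

(** Words mix all the maps, so one ratio must serve them all; a maximum of finitely many ratios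
    stays below 1. *)
Lemma contractions_ratio :
  exists2 q : R, 0 <= q < 1 &
    forall i x y, mdist (S i x) (S i y) <= q * mdist x y.
Proof.
have /choice[q qP] i : exists q : R, 0 <= q < 1 /\
    forall x y, mdist (S i x) (S i y) <= q * mdist x y.
  by have [q ? ?] := @S_contr i; exists q.
exists (\big[Num.max/0]_i q i).
  rewrite bigmax_idl le_max lexx /= -bigmax_idl.
  by apply: bigmax_lt => // i _; case: (qP i) => /andP[].
move=> i x y; apply: le_trans (_ : q i * mdist x y <= _); first exact: (qP i).2.
by apply: ler_wpM2r; [exact: mdist_ge0 | exact: le_bigmax].
Qed.

Lemma compact_mdist_bounded : exists D : R, forall x y, K x -> K y -> mdist x y < D.
Proof.
case: K_attr => -[x0 _] cK _.
(* Near each point of [K] the distance to [x0] is below [n] for all large [n]; compactness yields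
   one [N] for all of [K]. *)
have := (compact_near_coveringP K).1 cK nat \oo (fun n y => mdist x0 y < n%:R) _.
case=> [x Kx|N _ /(_ N (leqnn N)) KN].
  near=> y n => /=.
  apply: le_lt_trans (metric_triangle _ x _) _.
  apply: (@lt_le_trans _ _ (mdist x0 x + 1)); last by near: n; exact: nbhs_infty_ger.
  rewrite ltrD2l; near: y.
  have := nbhsx_ballx x 1 ltr01; rewrite ballEmdist; exact.
exists (N%:R + N%:R) => x y Kx Ky; apply: le_lt_trans (metric_triangle _ x0 _) _.
by apply: ltrD; [rewrite metric_sym|]; exact: KN.
Unshelve. all: by end_near. Qed.

(** Distances inside the piece of [w] are at most [q ^+ size w] times a bound [D] for distances in
    [K]. *)
Lemma word_piece_small (e : R) : 0 < e -> exists n, forall w x y,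
  (n <= size w)%N -> word_piece w x -> word_piece w y -> mdist x y < e.
Proof.
move=> e0; have [q /andP[q0 q1] qS] := contractions_ratio.
have [D KD] := compact_mdist_bounded.
have wS w x y : mdist (word_map w x) (word_map w y) <= q ^+ size w * mdist x y.
  elim: w => [|i w IH] /=; first by rewrite mul1r.
  by rewrite exprS -mulrA; apply: le_trans (qS _ _ _) _; exact: ler_wpM2l.
have D0 : 0 < D.
  by case: K_attr => -[x0 K0] _ _; have := KD _ _ K0 K0; rewrite mdistxx.
have /cvg_expr/cvgrPdist_lt/(_ (e / D) (divr_gt0 e0 D0))[n _ qn] : `|q| < 1.
  by rewrite ger0_norm.
exists n.
move=> w _ _ nw [x Kx <-] [y Ky <-]; apply: le_lt_trans (wS _ _ _) _.
have := qn _ nw; rewrite /= sub0r normrN ger0_norm ?exprn_ge0// ltr_pdivlMr// => {}qn.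
by apply: le_lt_trans qn; apply: ler_wpM2l; [exact: exprn_ge0 | exact/ltW/KD].
Qed.

Lemma word_map_continuous w : continuous (word_map w).
Proof.
elim: w => [|i w IH] x; first exact: cvg_id.
apply: continuous_comp; first exact: IH.
have [q /andP[q0 q1] qS] := @S_contr i.
apply/cvg_ballP => e e0; near=> y; rewrite ballEmdist /=.
apply: le_lt_trans (qS _ _) _; apply: (@le_lt_trans _ _ (mdist (word_map w x) y)).
  by apply: ler_piMl; [exact: mdist_ge0 | exact: ltW].
near: y; have := nbhsx_ballx (word_map w x) e e0; rewrite ballEmdist; exact.
Unshelve. all: by end_near. Qed.

Lemma word_piece_closed w : closed (word_piece w).
Proof.
apply: compact_closed; first exact: metric_hausdorff.
apply: continuous_compact; last by case: K_attr.
by apply: continuous_subspaceT; exact: word_map_continuous.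
Qed.

(** Appending [i] to a word that sends [S i q] into the critical set gives one for [q]. Hence every
    preimage in [K] of a boundary point is the target of an edge. *)
Lemma boundary_preimage i q : K q -> P (S i q) -> P q.
Proof.
move=> Kq [_ [w w0 Cw]]; split=> //; exists (rcons w i).
  by case: (w).
by rewrite -cats1 word_map_cat.
Qed.

Lemma critical_preimage i q : K q -> critical_set S K (S i q) -> P q.
Proof. by move=> Kq Cq; split=> //; exists [:: i]. Qed.

(** Injectivity cancels the common prefix; at the first differing letters, the rest of [u] carries
    [q] into two distinct first-level pieces. *)
Lemma word_piece_boundary u v q : size u = size v -> u != v ->
  K q -> word_piece v (word_map u q) -> P q.
Proof.
move=> + + Kq; elim: u v => [|i u IH] [|j v] //= [suv] uv [z Kz /= vz].
have [ij|ij] := eqVneq i j.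
  apply: (IH v) => //; first by apply: contra_neq uv => ->; rewrite ij.
  by exists z => //; apply: (@S_inj j); rewrite vz ij.
split=> //; exists (i :: u) => //=; exists i, j; split=> //.
  by exists (word_map u q) => //; exact: word_map_K.
by rewrite -vz; exists (word_map v z) => //; exact: word_map_K.
Qed.

(** The pieces shrink to diameter zero, so their intersection never has a second point. *)
Lemma is_addressP x a :
  is_address S K x a <-> forall n, word_piece (mkseq a n.+1) x.
Proof.
split=> [ax n|ax].
  by have : [set x] x by []; rewrite ax; apply.
apply/seteqP; split=> [_ -> n _|y ay]; first exact: ax.
apply: contrapT => /eqP; rewrite -mdist_gt0 => xy.
have [n /(_ (mkseq a n.+1) y x)] := word_piece_small xy.
by rewrite size_mkseq ltxx => /(_ (leqnSn n) (ay n I) (ax n)).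
Qed.

End Words.

(** * Bounding orders by counting the words whose pieces contain a point *)

Section Order.
Context {R : realType} {X : metricType R} {m : nat}.
Context (S : 'I_m -> X -> X) (K : set X).
Context (S_inj : forall i, injective (S i)).
Context (S_contr : forall i, metric_contraction (S i)).
Context (K_attr : is_attractor S K).

Local Notation P := (self_similar_boundary S K).
Local Notation word_map := (word_map S).
Local Notation word_piece := (word_piece S K).

(** The level-[n] pieces containing [x] and the remaining ones form two closed sets covering the
    component. It meets both, hence their intersection, which consists of images of boundary
    points. *)
Lemma component_meets_boundary n x y :
  connected K -> locally_connected K -> K x -> (K `\ x) y ->
  (forall w, size w = n -> word_piece w x -> ~ word_piece w y) ->
  exists w p, [/\ size w = n, word_piece w x, P p &
    connected_component (K `\ x) y (word_map w p)].
Proof.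
move=> cK lcK Kx Kxy nwy; set A := connected_component _ _.
have cptK : compact K by case: K_attr.
have Ay : A y by exact: connected_component_refl.
have AKx : A `<=` K `\ x by exact: connected_component_sub.
(* Tuples form a finite type, so each [F D] is a finite union of closed pieces. *)
pose F (D : set (n.-tuple 'I_m)) := \bigcup_(w in D) word_piece (val w).
have cF D : closed (F D).
  apply: closed_bigcup => [|w _].
    exact: finite_finset.
  exact: word_piece_closed.
pose Dx : set (n.-tuple 'I_m) := [set w | word_piece (val w) x].
have FT z : K z -> exists w : n.-tuple 'I_m, word_piece (val w) z.
  by move=> /(word_piece_cover K_attr n)[w /eqP sw wz]; exists (Tuple sw).
have AF : A `<=` F Dx `|` F (~` Dx).
  move=> z /AKx[/FT[w wz] _].
  by have [wx|wx] := pselect (Dx w); [left | right]; exists w.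
have AFDx : A `&` F Dx !=set0.
  have [z [Az nFz]] : A `&` ~` F (~` Dx) !=set0.
    apply: component_closure => //; apply: open_nbhs_nbhs; split.
      exact: closed_openC.
    by move=> [w].
  by exists z; split=> //; case: (AF z Az).
have AFDx' : A `&` F (~` Dx) !=set0.
  exists y; split=> //; case: (AF y Ay) => // -[w wx wy].
  by case: (nwy (val w)) => //; rewrite size_tuple.
have [z [Az [[w wx [q Kq wq]] [v vx vz]]]] :=
  connected_closed_cover (@component_connected _ _ _) (cF _) (cF _) AF AFDx AFDx'.
exists (val w), q; split=> //; [by rewrite size_tuple | | by rewrite wq].
apply: (@word_piece_boundary _ _ _ _ _ S_inj K_attr (val w) (val v)) => //.
- by rewrite !size_tuple.
- by apply/eqP => /val_inj wv; apply: vx; rewrite -wv.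
- by rewrite wq.
Qed.

(** Too many components would each contain one of the at most [N * size s] points [word_map w p],
    although components are disjoint. The level [n] depends on the chosen components, so [N] must be
    uniform in [n]. *)
Lemma order_le_words N (s : seq X) x :
  connected K -> locally_connected K -> P `<=` [set` s] -> K x ->
  (forall n, exists2 L : seq (seq 'I_m), (size L <= N)%N &
     forall w, size w = n -> word_piece w x -> w \in L) ->
  order_le K x (N * size s).
Proof.
move=> cK lcK Ps Kx xL; set M := (N * size s)%N.
apply: contrapT => /not_card_le_II/pcard_leP[f].
have /choice[y fy] k : exists y, (k <= M)%N ->
    (K `\ x) y /\ connected_component (K `\ x) y = f k.
  have [kM|] := leqP k M; last by exists x.
  have [y Ky yf] : components (K `\ x) (f k) by exact: funS.
  by exists y.
(* Pieces smaller than [e] that contain [x] contain none of the chosen points [y k]. *)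
pose e : R := \big[Num.min/1%R]_(k < M.+1) mdist x (y k).
have e0 : (0 < e)%R.
  apply: lt_bigmin => // k _; rewrite mdist_gt0.
  by case: (fy k (ltn_ord k)) => -[_ /eqP]; rewrite eq_sym.
have [n nP] := word_piece_small S_contr K_attr e0.
have [L LN Lw] := xL n.
pose B := [seq word_map w p | w <- L, p <- s].
have /choice[z zP] k : exists z, (k <= M)%N -> z \in B /\ f k z.
  have [kM|] := leqP k M; last by exists x.
  have [[Ky xy] <-] := fy k kM.
  have [//|w sw wx wy|w [p [sw wx Pp Cp]]] :=
      @component_meets_boundary n x (y k) cK lcK Kx.
    have := nP w x (y k); rewrite sw leqnn => /(_ isT wx wy); rewrite ltNge.
    by rewrite /e (bigmin_le_cond _ (j := Ordinal (kM : (k < M.+1)%N))).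
  exists (word_map w p) => _; split=> //; apply/allpairsP; exists (w, p).
  by split=> //; [exact: Lw | exact: Ps].
have zinj k l : (k <= M)%N -> (l <= M)%N -> z k = z l -> k = l.
  move=> kM lM zkl; have [[_ fk] [_ fl]] := (zP k kM, zP l lM).
  apply: (@inj _ _ _ f); rewrite ?inE //.
  have [[_ fyk] [_ fyl]] := (fy k kM, fy l lM).
  move: fk fl; rewrite zkl -fyk -fyl.
  move=> /same_connected_component ykl /same_connected_component yl.
  exact: etrans (esym fyk) (etrans ykl (etrans (esym yl) fyl)).
have : (size [seq z k | k <- iota 0 M.+1] <= size B)%N.
  apply: uniq_leq_size.
    rewrite map_inj_in_uniq ?iota_uniq// => k l; rewrite !mem_iota /= => kM lM.
    exact: zinj.
  by move=> u /mapP[k]; rewrite mem_iota /= => kM ->; case: (zP k kM).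
rewrite size_map size_iota size_allpairs ltnNge => /negP; apply.
exact: leq_mul.
Qed.

Lemma alphabet_gt0 : (0 < m)%N.
Proof.
case: K_attr => -[x Kx] _ _; have [i _] := attractorE K_attr Kx.
by case: i => i; exact: leq_ltn_trans.
Qed.

(** By injectivity each of the [m] possible first letters leaves a single preimage, so branching
    costs a factor [m]. *)
Lemma words_cons n b x :
  (forall i q, K q -> S i q = x ->
     exists2 L : seq (seq 'I_m), (size L <= b)%N &
       forall w, size w = n -> word_piece w q -> w \in L) ->
  exists2 L : seq (seq 'I_m), (size L <= m * b)%N &
    forall w, size w = n.+1 -> word_piece w x -> w \in L.
Proof.
move=> xL.
have /choice[L LP] i : exists L : seq (seq 'I_m), (size L <= b)%N /\
    forall w, size w = n -> word_piece (i :: w) x -> w \in L.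
  have [[q [Kq qx]]|nq] := pselect (exists q, K q /\ S i q = x).
    have [L Lb LP] := xL i q Kq qx; exists L; split=> // w sw [y Ky wy].
    by apply: LP => //; exists y => //; apply: (@S_inj i); rewrite qx.
  exists [::]; split=> // w _ [y Ky wy]; case: nq.
  by exists (word_map w y); split=> //; exact: word_map_K.
exists [seq i :: w | i <- enum 'I_m, w <- L i]; last first.
  move=> [|i w] // [sw] wx; apply/allpairsPdep; exists i, w.
  by split=> //; [rewrite mem_enum | exact: (LP i).2].
rewrite size_allpairs_dep sumnE big_map big_enum /=.
apply: leq_trans (_ : \sum_(i < m) b <= _)%N.
  by apply: leq_sum => i _; case: (LP i).
by rewrite sum_nat_const card_ord.
Qed.

(** Without branching the first letter is forced and the bound does not grow. *)
Lemma words_cons_unique n b x i q :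
  (forall j r, K r -> S j r = x -> j = i /\ r = q) ->
  (exists2 L : seq (seq 'I_m), (size L <= b)%N &
     forall w, size w = n -> word_piece w q -> w \in L) ->
  exists2 L : seq (seq 'I_m), (size L <= b)%N &
    forall w, size w = n.+1 -> word_piece w x -> w \in L.
Proof.
move=> xq [L Lb LP]; exists [seq i :: w | w <- L]; first by rewrite size_map.
move=> [|j w] // [sw] [y Ky wy].
have [ji wq] := xq j (word_map w y) (word_map_K K_attr _ Ky) wy.
by rewrite ji map_f //; apply: LP => //; exists y.
Qed.

(* The number of vertices reachable from p strictly decreases along every edge
   leaving a non-cyclic vertex, and a cyclic vertex offers no branching. *)
Lemma boundary_words (s : seq X) n p : P = [set` s] ->
  ~ (exists p, cyclic_vertex S K p /\ `I_2 #<= out_edges S K p) -> P p ->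
  exists2 L : seq (seq 'I_m),
    (size L <= m ^ count (fun q => `[< predecessor S K p q >]) s)%N &
    forall w, size w = n -> word_piece w p -> w \in L.
Proof.
move=> Ps no2; pose r q := count (fun u => `[< predecessor S K q u >]) s.
rewrite -/(r p).
have m0 := alphabet_gt0.
elim: n p => [|n IH] p Pp.
  by exists [:: [::]]; [rewrite expn_gt0 m0 | case].
have edge i q : K q -> S i q = p -> index_edge S K p i q.
  move=> Kq qp; split=> //; apply: (boundary_preimage (i := i)) => //.
  by rewrite qp.
(* The edge prepends to every walk starting at [q]. *)
have rle i q : index_edge S K p i q -> (r q <= r p)%N.
  move=> pq; apply: sub_count => u /asboolP[t tu]; apply/asboolP.
  by exists ((i, q) :: t).
have [cp|ncp] := pselect (cyclic_vertex S K p).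
  have [i [q Kq qp]] := attractorE K_attr Pp.1.
  have pq := edge i q Kq qp; have [_ Pq _] := pq.
  apply: (@words_cons_unique n _ p i q).
    move=> j u Ku up; have pu := edge j u Ku up.
    suff [-> ->] : (j, u) = (i, q) by [].
    apply: (@card_lt2_unique _ (out_edges S K p)); [|exact: pu|exact: pq].
    by move=> I2; apply: no2; exists p.
  have [L Lq LP] := IH q Pq; exists L => //; apply: leq_trans Lq _.
  by rewrite leq_pexp2l// (rle i).
have ps : p \in s by have := Pp; rewrite Ps.
have rp : (0 < r p)%N.
  by rewrite -has_count; apply/hasP; exists p => //; apply/asboolP; exists [::].
rewrite -(prednK rp) expnS; apply: words_cons => i q Kq qp.
have pq := edge i q Kq qp; have [_ Pq _] := pq.
have [L Lq LP] := IH q Pq; exists L => //; apply: leq_trans Lq _.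
rewrite leq_pexp2l// -ltnS (prednK rp).
(* A walk back from [q] would close up with the edge to a cycle through [p]. *)
have qNp : ~ predecessor S K q p.
  move=> [t tp]; apply: ncp; exists p, ((i, q) :: t).
  by split; [split | rewrite mem_head].
(* The entries reachable from [q] and those equal to [p] are disjoint and all counted in [r p]; as
   [p] occurs in [s], this gives [r q < r p]. *)
apply: (@leq_trans (r q + count_mem p s)%N).
  by rewrite -[X in (X < _)%N]addn0 ltn_add2l -has_count has_pred1.
rewrite -count_predUI (@eq_count _ (predI _ _) pred0) ?count_pred0 ?addn0; last first.
  by move=> u /=; apply/andP => -[/asboolP qu /eqP up]; apply: qNp; rewrite -up.
apply: sub_count => u /= /orP[/asboolP[t tu]|/eqP->]; apply/asboolP.
  by exists ((i, q) :: t).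
by exists [::].
Qed.

(** Off the critical set there is only one preimage. At the first critical point all preimages lie
    in the boundary, where [boundary_words] takes over, so the factor [m] is paid only once. *)
Lemma attractor_words (s : seq X) n x : P = [set` s] ->
  ~ (exists p, cyclic_vertex S K p /\ `I_2 #<= out_edges S K p) -> K x ->
  exists2 L : seq (seq 'I_m), (size L <= m * m ^ size s)%N &
    forall w, size w = n -> word_piece w x -> w \in L.
Proof.
move=> Ps no2.
have m0 := alphabet_gt0.
elim: n x => [|n IH] x Kx.
  by exists [:: [::]]; [rewrite muln_gt0 expn_gt0 m0 | case].
have [Cx|nCx] := pselect (critical_set S K x).
  apply: words_cons => i q Kq qx.
  have [|L Lq LP] := @boundary_words s n q Ps no2.
    by apply: (critical_preimage (i := i)) => //; rewrite qx.
  exists L => //; apply: leq_trans Lq _.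
  by rewrite leq_pexp2l// count_size.
have [i [q Kq qx]] := attractorE K_attr Kx.
apply: (@words_cons_unique n _ x i q); last exact: IH.
move=> j u Ku ux; have ij : j = i.
  apply: contrapT => /eqP ji; apply: nCx; exists j, i.
  by split=> //; [exists u | exists q].
by split=> //; apply: (@S_inj i); rewrite qx -ij.
Qed.

End Order.

(** * Finite and infinite walks in the index diagram *)

Section Walks.
Context {R : realType} {X : metricType R} {m : nat}.
Context (S : 'I_m -> X -> X) (K : set X).

Local Notation P := (self_similar_boundary S K).
Local Notation is_walk := (is_walk S K).
Local Notation index_edge := (index_edge S K).
Local Notation infinite_walks := (infinite_walks S K).
Implicit Types (p q r : X) (s t : seq ('I_m * X)).

Lemma is_walk_cat p s t q :
  is_walk p (s ++ t) q <-> exists2 r, is_walk p s r & is_walk r t q.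
Proof.
elim: s p => [|[k u] s IH] p /=.
  split=> [pq|[r [_ ->] //]]; exists p => //; split=> //.
  by case: t pq => [[]|[k r] t [[]]].
split=> [[pu /IH[r ur rq]]|[r [pu ur] rq]]; first by exists r.
by split=> //; apply/IH; exists r.
Qed.

Lemma is_walk_last p s q : is_walk p s q -> q = last p [seq e.2 | e <- s].
Proof. by elim: s p => [|[k r] s IH] p /= [] // _ /IH. Qed.

Lemma is_walk_nth p s q e i : is_walk p s q -> (i < size s)%N ->
  index_edge (nth p (walk_vertices p s) i) (nth e s i).1 (nth e s i).2.
Proof.
elim: s p i => [|[k r] s IH] p [|i] //= [] // _ rq si.
have := IH r i rq si; rewrite /walk_vertices (set_nth_default p) //=.
by rewrite size_map ltnW.
Qed.

Lemma walk_edges_cat p s q t : is_walk p s q ->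
  walk_edges p (s ++ t) = walk_edges p s ++ walk_edges q t.
Proof.
elim: s p => [|[k r] s IH] p /= [] //; first by move=> _ ->.
by move=> _ /IH rq; rewrite /walk_edges /=; congr (_ :: _); exact: rq.
Qed.

Lemma is_walk_split p s q r : is_walk p s q -> r \in walk_vertices p s ->
  exists s1 s2, [/\ s = s1 ++ s2, is_walk p s1 r & is_walk r s2 q].
Proof.
elim: s p => [|[k u] s IH] p wpq; rewrite /walk_vertices /= inE.
  move=> /eqP ->; case: wpq => Pp pq.
  by exists [::], [::].
have [pu uq] := wpq; have [Pp _ _] := pu.
case/orP=> [/eqP ->|/(IH u uq)[s1 [s2 [-> ur rq]]]].
  by exists [::], ((k, u) :: s).
by exists ((k, u) :: s1), s2.
Qed.

(** Cutting at [p] and swapping the two arcs only permutes the edges; cycles based at the same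
    vertex can then be concatenated. *)
Lemma cycle_rotate p0 s p : is_cycle S K p0 s -> p \in walk_vertices p0 s ->
  exists2 t, is_cycle S K p t & walk_edges p t =i walk_edges p0 s.
Proof.
move=> [s0 wps] /(is_walk_split wps)[s1 [s2 [sE w1 w2]]].
exists (s2 ++ s1); last first.
  move=> e; rewrite sE (walk_edges_cat _ w1) (walk_edges_cat _ w2).
  by rewrite !mem_cat orbC.
split; last by apply/is_walk_cat; exists p0.
by move: s0; rewrite sE -!size_eq0 !size_cat addnC.
Qed.

(* Commuting words are powers of a common word; the proof is Euclid's algorithm
   on the lengths. *)
Lemma commuting_cycles_edges p s t : s != [::] -> t != [::] ->
  is_walk p s p -> is_walk p t p -> s ++ t = t ++ s ->
  walk_edges p s =i walk_edges p t.
Proof.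
have [n] := ubnP (size s + size t); elim: n s t => // n IH s t.
wlog st : s t / (size s <= size t)%N => [H stn s0 t0 ws wt stE|].
  have [st|/ltnW ts] := leqP (size s) (size t); first exact: H.
  by move=> e; rewrite (H t s) // addnC.
move=> stn s0 t0 ws wt stE.
(* Comparing prefixes of length [size s] in the two products shows that [t] begins with [s]. *)
have tE : t = s ++ drop (size s) t.
  rewrite -{1}(cat_take_drop (size s) t); congr (_ ++ _).
  by rewrite -(takel_cat s st) -stE take_size_cat.
move: tE; set d := drop _ _ => tE.
have [d0|d0] := eqVneq d [::]; first by rewrite tE d0 cats0.
have wd : is_walk p d p.
  have := wt; rewrite tE => /is_walk_cat[r sr].
  by rewrite (is_walk_last sr) -(is_walk_last ws).
(* Cancelling [s] leaves the shorter commuting pair [s], [d]. *)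
have sdE : s ++ d = d ++ s.
  by move/eqP: stE; rewrite tE -catA eqseq_cat // eqxx /= => /eqP.
have sdEE : walk_edges p s =i walk_edges p d.
  apply: IH => //; rewrite -ltnS; apply: leq_trans stn.
  rewrite [in X in (_ < X)%N]tE size_cat ltnS -[X in (X < _)%N]add0n ltn_add2r.
  by rewrite lt0n size_eq0.
by move=> e; rewrite tE (walk_edges_cat _ ws) mem_cat -sdEE orbb.
Qed.

(** Prepending the edge injects the walks from [q] into those from [p]. *)
Lemma infinite_walks_cons p k q : index_edge p k q ->
  countable (infinite_walks p) -> countable (infinite_walks q).
Proof.
move=> pq /countable_injP[f finj]; apply/countable_injP.
pose c (w : (nat -> X) * (nat -> 'I_m)) :=
  ((fun n => if n is n'.+1 then w.1 n' else p),
   (fun n => if n is n'.+1 then w.2 n' else k)).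
have cW w : infinite_walks q w -> infinite_walks p (c w).
  by move=> [w0 wE]; split=> // -[|i] /=; [rewrite w0 | exact: wE].
exists (f \o c) => -[v l] [v' l']; rewrite !inE => vW vW' /= fE.
have [vE lE] : c (v, l) = c (v', l') by apply: finj; rewrite ?inE //; exact: cW.
by congr pair; apply/funext => n;
  [have := congr1 (@^~ n.+1) vE | have := congr1 (@^~ n.+1) lE].
Qed.

Lemma infinite_walks_walk p s q : is_walk p s q ->
  countable (infinite_walks p) -> countable (infinite_walks q).
Proof.
elim: s p => [|[k r] s IH] p /= [] => [_ -> //|pr rq cp].
exact: IH rq (infinite_walks_cons pr cp).
Qed.

(** Closed walks at [p] of equal length are glued end to end; the formula for the [n]-th edge lets
    the blocks be read back. *)
Lemma infinite_walk_of_blocks p (L : nat) (e : 'I_m * X)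
    (blk : nat -> seq ('I_m * X)) : (0 < L)%N ->
  (forall n, size (blk n) = L) -> (forall n, is_walk p (blk n) p) ->
  exists2 w, infinite_walks p w &
    forall n, (w.2 n, w.1 n.+1) = nth e (blk (n %/ L)%N) (n %% L)%N.
Proof.
move=> L0 sz wk.
pose w := (fun n => nth p (walk_vertices p (blk (n %/ L)%N)) (n %% L)%N,
           fun n => (nth e (blk (n %/ L)%N) (n %% L)%N).1).
have wS n : w.1 n.+1 = (nth e (blk (n %/ L)%N) (n %% L)%N).2.
  have nL : (n %% L < size (blk (n %/ L)%N))%N by rewrite sz ltn_mod.
  rewrite -(nth_map _ p snd) //= divnS // modnS.
  case: ifPn => [Ln|_]; last by rewrite add0n.
  (* If [L] divides [n.+1], position [n %% L] is the last of its block, which ends at [p], where the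
     next block starts. *)
  have -> : (n %% L = (size [seq e.2 | e <- blk (n %/ L)%N]).-1)%N.
    rewrite size_map sz; apply/eqP; rewrite -eqSS prednK // eqn_leq ltn_mod L0 /=.
    move: Ln; rewrite {1}(divn_eq n L) -addnS dvdn_addr ?dvdn_mull //.
    exact: dvdn_leq.
  by rewrite nth_last -(is_walk_last (wk _)).
exists w; last by move=> n; rewrite wS /= -surjective_pairing.
split=> [|n]; first by rewrite /w /= mod0n.
by rewrite wS; apply: is_walk_nth; [exact: wk | rewrite sz ltn_mod].
Qed.

(** Each boolean sequence selects the blocks of its own infinite walk, so Cantor's argument
    applies. *)
Lemma two_cycles_uncountable p : in_two_cycles S K p ->
  ~ countable (infinite_walks p).
Proof.
move=> [p1 [s1 [p2 [s2 [[c1 c2] ps1 ps2 E12]]]]].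
have [t1 [t10 w1] E1] := cycle_rotate c1 ps1.
have [t2 [t20 w2] E2] := cycle_rotate c2 ps2.
pose blk (b : bool) := if b then t1 ++ t2 else t2 ++ t1.
have blk_inj : injective blk.
  have t12 : t1 ++ t2 <> t2 ++ t1.
    move=> /(commuting_cycles_edges t10 t20 w1 w2) E; apply: E12 => e.
    by rewrite -E1 -E2.
  by move=> [] [] //= /esym // /esym.
have wblk b : is_walk p (blk b) p by case: b; apply/is_walk_cat; exists p.
pose L := (size t1 + size t2)%N.
have sblk b : size (blk b) = L by case: b; rewrite size_cat // addnC.
have L0 : (0 < L)%N by rewrite addn_gt0 lt0n size_eq0 t10.
have [e _] : exists e : 'I_m * X, True by case: (t1) t10 => // e; exists e.
have /choice[W WP] (b : nat -> bool) : exists w, infinite_walks p w /\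
    forall n, (w.2 n, w.1 n.+1) = nth e (blk (b (n %/ L)%N)) (n %% L)%N.
  have [w wp wE] := @infinite_walk_of_blocks p L e (blk \o b) L0
    (fun n => sblk (b n)) (fun n => wblk (b n)).
  by exists w.
have Winj : injective W.
  move=> b b' WE; apply/funext => n; apply: blk_inj.
  (* Edge [n * L + j] of the walk is edge [j] of block [n]. *)
  apply: (@eq_from_nth _ e); first by rewrite !sblk.
  move=> j; rewrite sblk => jL.
  have [_ /(_ (n * L + j)%N)] := WP b; have [_ /(_ (n * L + j)%N)] := WP b'.
  by rewrite WE divnMDl // divn_small // addn0 modnMDl modn_small // => -> ->.
move=> /countable_injP[f finj].
have gP b b' : f (W b) = f (W b') -> b = b'.
  move=> fE; apply: Winj; apply: finj; rewrite ?inE //.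
    by case: (WP b).
  by case: (WP b').
(* Cantor's diagonal argument. *)
pose b n := `[< exists2 c, f (W c) = n & ~~ c n >].
have bP : b (f (W b)) <-> ~~ b (f (W b)).
  split=> [/asboolP[c /gP -> //]|nb]; by apply/asboolP; exists b.
by case: (b _) bP => -[]; [move=> /(_ isT) | move=> _ /(_ isT)].
Qed.

(** Unfolding [S k q = p] along [n] edges; this makes the label sequence an address of the
    vertex. *)
Lemma infinite_walk_word w p i n : infinite_walks p w ->
  w.1 i = word_map S (mkseq (fun j => w.2 (i + j)%N) n) (w.1 (i + n)%N).
Proof.
move=> [_ wE]; elim: n => [|n IH]; first by rewrite addn0.
rewrite mkseqS -cats1 word_map_cat IH addnS /=.
by have [_ _ ->] := wE (i + n)%N.
Qed.

(** * Walks forced by outdegree one *)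

Section OutdegreeOne.
Context (w : (nat -> X) * (nat -> 'I_m)) (p0 : X).
Context (K_attr : is_attractor S K).
Context (w_walk : infinite_walks p0 w).
Context (w_out1 : forall i, out_edges S K (w.1 i) #= `I_1).

Lemma outdegree1_edge i k q : index_edge (w.1 i) k q ->
  k = w.2 i /\ q = w.1 i.+1.
Proof.
move=> ikq; suff [-> ->] : (k, q) = (w.2 i, w.1 i.+1) by [].
apply: (@card_lt2_unique _ (out_edges S K (w.1 i))) => //.
  by rewrite (card_le_eqr (w_out1 i)) card_le_II.
by case: w_walk => _; exact.
Qed.

(** Finiteness of the boundary makes a vertex recur, and with outdegree one the walk then repeats
    itself, vertices and labels. *)
Lemma outdegree1_preperiodic i : finite_set P ->
  preperiodic (fun j => w.2 (i + j)%N).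
Proof.
move=> /finite_seqP[s Ps]; have [_ wE] := w_walk.
have /(uniqPn p0)[a [b [ab]]] :
    ~~ uniq [seq w.1 (i + j)%N | j <- iota 0 (size s).+1].
  apply/negP => /uniq_leq_size-/(_ s); rewrite size_map size_iota ltnn.
  suff ws : {subset [seq w.1 (i + j)%N | j <- iota 0 (size s).+1] <= s}.
    by move=> /(_ ws).
  move=> u /mapP[j _ ->]; have [+ _ _] := wE (i + j)%N.
  by rewrite Ps.
rewrite size_map size_iota => bs; have as_ := ltn_trans ab bs.
rewrite !(nth_map 0%N) ?size_iota // !nth_iota // !add0n => wab.
have wper n : w.1 (i + (n + a + (b - a)))%N = w.1 (i + (n + a))%N.
  elim: n => [|n IH]; first by rewrite add0n subnKC // ltnW.
  have := wE (i + (n + a + (b - a)))%N.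
  by rewrite IH => /outdegree1_edge[_]; rewrite !addSn !addnS.
exists a, (b - a)%N; split=> [|n an]; first by rewrite subn_gt0.
have := wE (i + (n - a + a + (b - a)))%N.
by rewrite wper subnK // => /outdegree1_edge[].
Qed.

(** Removing the first letter moves to a preimage, which is again a boundary point, so the step is
    an edge and must be the one the walk takes. *)
Lemma outdegree1_word v i : word_piece S K v (w.1 i) ->
  v = mkseq (fun j => w.2 (i + j)%N) (size v).
Proof.
elim: v i => [|k v IH] i //= [y Ky vy].
have [Pi _ _] : index_edge (w.1 i) (w.2 i) (w.1 i.+1) by case: w_walk => _; exact.
have Kv : K (word_map S v y) by exact: word_map_K.
have /outdegree1_edge[kE vE] : index_edge (w.1 i) k (word_map S v y).
  by split=> //; apply: (boundary_preimage (i := k)) => //; move: Pi; rewrite -vy.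
have -> : v = mkseq (fun j => w.2 (i.+1 + j)%N) (size v) by apply: IH; exists y.
rewrite size_mkseq kE /mkseq /= addn0 (iotaDl 1 0) -map_comp.
by congr (_ :: _); apply: eq_map => j /=; rewrite addSnnS.
Qed.

End OutdegreeOne.

End Walks.

Theorem theorem5p5 (R : realType) (X : completeMetricType R) (m : nat)
    (S : 'I_m -> X -> X) (K : set X)
    (S_inj : forall i, injective (S i))
    (S_contr : forall i, metric_contraction (S i))
    (K_attr : is_attractor S K)
    (K_dendrite : dendrite K)
    (P_fin : finite_set (self_similar_boundary S K)) :
  [/\ (~ (exists p, cyclic_vertex S K p /\ `I_2 #<= out_edges S K p) ->
        exists N : nat, forall x, K x -> order_le K x N),
      (forall p w, self_similar_boundary S K p -> infinite_walks S K p w ->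
        (forall i, out_edges S K (w.1 i) #= `I_1) ->
        forall i, exists a : nat -> 'I_m,
          [/\ is_address S K (w.1 i) a,
              (forall b, is_address S K (w.1 i) b -> b = a) &
              preperiodic a]) &
      (forall p, in_two_cycles S K p ->
        forall p', strict_predecessor S K p' p ->
          ~ countable (infinite_walks S K p'))].
Proof.
have [_ _ cK lcK _] := K_dendrite.
split=> [no2|p w _ ww out1 i|p p2 p' [[s p'p] _] cp'].
- have [s Ps] := (finite_seqP _).1 P_fin.
  (* At most [m * m ^ size s] pieces of each level contain [x], and each carries at most [size s]
     images of boundary points. *)
  exists (m * m ^ size s * size s)%N => x Kx.
  apply: (@order_le_words _ _ _ S) => // [y|n]; first by rewrite Ps.
  exact: attractor_words.
- exists (fun j => w.2 (i + j)%N); split.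
  + apply/is_addressP => // n; rewrite (infinite_walk_word i n.+1 ww).
    exists (w.1 (i + n.+1)%N) => //.
    by case: ww => _ /(_ (i + n.+1)%N)[[]].
  + move=> b /is_addressP bw; apply/funext => n.
    have /(congr1 (fun v => nth (w.2 0%N) v n)) :=
      outdegree1_word K_attr ww out1 (bw S_contr K_attr n).
    by rewrite size_mkseq !nth_mkseq.
  + exact: outdegree1_preperiodic ww out1 _ P_fin.
(* Countability at [p'] would pass along the walk to [p]. *)
- exact: two_cycles_uncountable p2 (infinite_walks_walk p'p cp').
Qed.
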